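(* Let $u$ be the exact solution of the linear parabolic problem $u'(t)+Au(t)=f(t)$, $0\le t\le T$, $u(0)=u^0$, and let $U:[0,T]\to D(A)$ be the exponential midpoint approximation, i.e. the continuous piecewise linear interpolant of the nodal values produced by the exponential midpoint rule with $U^0=u^0$. Let $R(t)=U'(t)+AU(t)-f(t)$ for $t\in I_n$, $n=1,\dots,N$, and $e=u-U$. Then $$\max_{s\in[0,T]}|e(s)|^2\le\frac1{\lambda_1^2}\sup_{s\in(0,T]}|R(s)|^2 .$$
   Context: $(H,(\cdot,\cdot))$ is a Hilbert space with norm $|\cdot|$, and $A:D(A)\to H$ is a linear, self-adjoint, positive definite operator with $D(A)$ dense in $H$; $\lambda_1>0$ denotes its first eigenvalue. $V:=D(A^{1/2})$ with norm $\|v\|=|A^{1/2}v|$. The Poincaré inequality $|v|\le\lambda_1^{-1/2}\|v\|$ holds for all $v\in V$. The initial value is $u^0\in D(A)$, and $f:[0,T]\to H$ is sufficiently smooth ($f\in C^2([0,T];H)$). Let $0=t^0<t^1<\cdots<t^N=T$, $I_n:=(t^{n-1},t^n]$, $k_n:=t^n-t^{n-1}$, $t^{n-\frac12}:=\frac12(t^{n-1}+t^n)$. Define $\varphi_1(-kA)=\int_0^1e^{-(1-\tau)kA}\,d\tau$, a bounded operator on $H$. The exponential midpoint rule is $U^0=u^0$, $$U^n=e^{-k_nA}U^{n-1}+k_n\varphi_1(-k_nA)f(t^{n-\frac12}),\qquad n=1,\dots,N,$$ and the exponential midpoint approximation is $$U(t)=U^{n-1}+(t-t^{n-1})\frac{U^n-U^{n-1}}{k_n},\qquad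 t\in I_n,$$ with $U(0)=U^0$. On $I_n$, $U'$ denotes the constant $(U^n-U^{n-1})/k_n$. *)

(* Defs.v *)
From Stdlib Require Import Reals.
From Coquelicot Require Import Coquelicot.
Open Scope R_scope.

(** A complete normed space whose norm comes from the inner product [ip].
    Definiteness of [ip] follows from that of the norm. *)
Record is_hilbert (H : CompleteNormedModule R_AbsRing) (ip : H -> H -> R)
  : Prop := {
  ip_sym : forall x y : H, ip x y = ip y x;
  ip_plus_l : forall x y z : H, ip (plus x y) z = ip x z + ip y z;
  ip_scal_l : forall (a : R) (x y : H), ip (scal a x) y = a * ip x y;
  ip_nonneg : forall x : H, 0 <= ip x x;
  ip_norm : forall x : H, norm x = sqrt (ip x x)
}.

(** An operator with domain [D] is given by the predicate [D] and a total
    function; its values outside [D] are arbitrary and never constrained. *)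

Section Operators.

Context {H : CompleteNormedModule R_AbsRing}.

Record is_linear_op (D : H -> Prop) (A : H -> H) : Prop := {
  dom_zero : D zero;
  dom_plus : forall x y : H, D x -> D y -> D (plus x y);
  dom_scal : forall (a : R) (x : H), D x -> D (scal a x);
  op_plus : forall x y : H, D x -> D y -> A (plus x y) = plus (A x) (A y);
  op_scal : forall (a : R) (x : H), D x -> A (scal a x) = scal a (A x)
}.

Definition is_dense (D : H -> Prop) : Prop :=
  forall (x : H) (eps : posreal), exists y : H, D y /\ norm (minus y x) < eps.

(** [(y, z)] belongs to the graph of the adjoint. *)
Definition adjoint_graph (ip : H -> H -> R) (D : H -> Prop) (A : H -> H)
  (y z : H) : Prop :=
  forall x : H, D x -> ip (A x) y = ip x z.

(** [A] and its adjoint have the same graph, hence the same domain. *)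
Definition is_self_adjoint (ip : H -> H -> R) (D : H -> Prop) (A : H -> H)
  : Prop :=
  is_linear_op D A /\ is_dense D /\
  forall y z : H, (D y /\ A y = z) <-> adjoint_graph ip D A y z.

Definition is_positive_definite (ip : H -> H -> R) (D : H -> Prop) (A : H -> H)
  : Prop :=
  forall x : H, D x -> x <> zero -> 0 < ip (A x) x.

Definition is_eigenvalue (D : H -> Prop) (A : H -> H) (mu : R) : Prop :=
  exists w : H, D w /\ w <> zero /\ A w = scal mu w.

Definition is_first_eigenvalue (D : H -> Prop) (A : H -> H) (mu : R) : Prop :=
  is_eigenvalue D A mu /\ forall nu : R, is_eigenvalue D A nu -> mu <= nu.

(** [B], with domain [V], is the nonnegative self-adjoint square root of [A]:
    [A = B B] including the equality of domains. *)
Definition is_sqrt_op (ip : H -> H -> R) (D : H -> Prop) (A : H -> H)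
  (V : H -> Prop) (B : H -> H) : Prop :=
  is_self_adjoint ip V B /\
  (forall v : H, V v -> 0 <= ip (B v) v) /\
  (forall x : H, D x <-> V x /\ V (B x)) /\
  (forall x : H, D x -> A x = B (B x)).

(** [E t] is [e^{-tA}] for [t >= 0]: [E] is the strongly continuous semigroup of
    bounded operators whose infinitesimal generator, with its domain, is [-A]. *)
Record is_semigroup_exp (D : H -> Prop) (A : H -> H) (E : R -> H -> H)
  : Prop := {
  exp_bounded : forall t : R, 0 <= t -> is_linear (E t);
  exp_zero : forall x : H, E 0 x = x;
  exp_plus : forall (s t : R) (x : H),
    0 <= s -> 0 <= t -> E (s + t) x = E s (E t x);
  exp_continuous : forall x : H,
    continuous_on (fun t : R => 0 <= t) (fun t : R => E t x);
  exp_generator : forall x y : H,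
    (D x /\ opp (A x) = y) <->
    filterlim (fun h : R => scal (/ h) (minus (E h x) x))
      (at_right 0) (locally y)
}.

(** [phi_1(-kA) x], the operator-valued integral being taken strongly. *)
Definition phi1 (E : R -> H -> H) (k : R) (x : H) : H :=
  RInt (fun tau : R => E ((1 - tau) * k) x) 0 1.

Definition Icc (a b : R) : R -> Prop := fun x => a <= x <= b.

(** Derivative relative to [I] (one-sided at the endpoints of an interval). *)
Definition is_derive_within (I : R -> Prop) (g : R -> H) (x : R) (l : H)
  : Prop :=
  filterdiff g (within I (locally x)) (fun h : R => scal h l).

Definition is_C2_on (I : R -> Prop) (g : R -> H) : Prop :=
  exists g1 g2 : R -> H,
    (forall x : R, I x -> is_derive_within I g x (g1 x)) /\
    (forall x : R, I x -> is_derive_within I g1 x (g2 x)) /\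
    continuous_on I g2.

Definition is_exact_solution (D : H -> Prop) (A : H -> H) (T : R)
  (f : R -> H) (u0 : H) (u : R -> H) : Prop :=
  u 0 = u0 /\
  forall t : R, 0 <= t <= T ->
    D (u t) /\
    exists du : H,
      is_derive_within (Icc 0 T) u t du /\ plus du (A (u t)) = f t.

(** Subintervals are indexed from [0]: the one with index [n < N] is
    [(t n, t (S n)]], of length [step t n]. *)

Definition is_partition (T : R) (N : nat) (t : nat -> R) : Prop :=
  (1 <= N)%nat /\ t 0%nat = 0 /\ t N = T /\
  forall n : nat, (n < N)%nat -> t n < t (S n).

Definition step (t : nat -> R) (n : nat) : R := t (S n) - t n.

Fixpoint exp_midpoint (E : R -> H -> H) (f : R -> H) (t : nat -> R) (u0 : H)
  (n : nat) : H :=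
  match n with
  | O => u0
  | S m =>
      plus (E (step t m) (exp_midpoint E f t u0 m))
           (scal (step t m)
              (phi1 E (step t m) (f ((t m + t (S m)) / 2))))
  end.

Definition slope (t : nat -> R) (Un : nat -> H) (n : nat) : H :=
  scal (/ step t n) (minus (Un (S n)) (Un n)).

Definition is_pw_linear_interpolant (N : nat) (t : nat -> R) (Un : nat -> H)
  (U : R -> H) : Prop :=
  U 0 = Un 0%nat /\
  forall (n : nat) (s : R), (n < N)%nat -> t n < s <= t (S n) ->
    U s = plus (Un n) (scal (s - t n) (slope t Un n)).

(** On the subinterval [n], [U'] is the constant [slope t Un n], including at
    the right endpoint. *)
Definition is_residual (A : H -> H) (f : R -> H) (N : nat) (t : nat -> R)
  (Un : nat -> H) (U Res : R -> H) : Prop :=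
  forall (n : nat) (s : R), (n < N)%nat -> t n < s <= t (S n) ->
    Res s = minus (plus (slope t Un n) (A (U s))) (f s).

End Operators.

Definition is_max_on (I : R -> Prop) (g : R -> R) (M : R) : Prop :=
  (exists s : R, I s /\ g s = M) /\ forall s : R, I s -> g s <= M.

Definition is_sup_on (I : R -> Prop) (g : R -> R) (M : R) : Prop :=
  is_lub (fun y : R => exists s : R, I s /\ y = g s) M.

(* Main.v *)
Require Import Defs.
From Corelib Require Import ssreflect.
From Stdlib Require Import Reals Lra Lia.
From Coquelicot Require Import Coquelicot.
Open Scope R_scope.

(** No differential inequality has to be integrated: at a point [s > 0] where
    [|e|] attains its maximum, the left derivative [d] of [e] satisfies
    [(d, e s) >= 0], since [(e (s + h), e s) <= |e s|^2] for [h < 0]. Pairing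
    [d + A e = - R] with [e s] and using [(A e, e) >= lambda1 |e|^2], a form of
    the Poincare inequality, gives [lambda1 |e s| <= |R s|]; and [e 0 = 0].
    That the nodal values lie in [D] follows from
    [k phi_1(-kA) x = int_0^k E r x dr], whose difference quotient under [E]
    converges to [E k x - x]. *)

Lemma plus_plus_swap {G : AbelianMonoid} (a b c d : G) :
  plus (plus a b) (plus c d) = plus (plus a c) (plus b d).
Proof.
  rewrite -(plus_assoc a b) -(plus_assoc a c).
  apply f_equal. rewrite !plus_assoc. now rewrite (plus_comm b c).
Qed.

(** * Maxima on compact intervals and partitions of the time interval *)

Section RealIntervals.

(** Composing [g] with the projection [clamp] of the line onto the interval, which is 1-Lipschitz,
    turns relative continuity into continuity at every real point, so the classical extreme value
    theorem applies. *)
Lemma continuous_max_on (g : R -> R) (a b : R) :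
  a <= b -> continuous_on (Icc a b) g -> exists M, is_max_on (Icc a b) g M.
Proof.
  intros Hab Hg.
  set (clamp := fun x => Rmax a (Rmin b x)).
  assert (Hin : forall x, Icc a b (clamp x)).
  { intros x. unfold Icc, clamp, Rmax, Rmin.
    destruct (Rle_dec b x); destruct (Rle_dec a _); lra. }
  assert (Hid : forall x, Icc a b x -> clamp x = x).
  { intros x [H1 H2]. unfold clamp.
    now rewrite -> Rmin_right, Rmax_right by lra. }
  assert (Hclamp : forall x, continuity_pt (fun y => g (clamp y)) x).
  { intros x. apply continuity_pt_filterlim.
    apply (filterlim_comp _ _ _ clamp g _
             (within (Icc a b) (locally (clamp x)))).
    2: exact (Hg _ (Hin x)).
    intros P [d Hd]. exists d. intros y Hy. apply Hd; [|apply Hin].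
    revert Hy. change (Rabs (y - x) < d -> Rabs (clamp y - clamp x) < d).
    intros Hy. apply Rle_lt_trans with (2 := Hy).
    unfold clamp, Rmax, Rmin.
    repeat destruct (Rle_dec _ _); unfold Rabs;
      repeat destruct (Rcase_abs _); lra. }
  destruct (continuity_ab_maj (fun y => g (clamp y)) a b Hab) as [m [Hm Hm2]].
  { intros; apply Hclamp. }
  exists (g m). split.
  - exists m. now split.
  - intros s Hs. specialize (Hm s Hs). simpl in Hm.
    rewrite (Hid s Hs) (Hid m Hm2) in Hm. exact Hm.
Qed.

Lemma is_max_on_concat (g : R -> R) (a b c M1 M2 : R) :
  a <= b -> b <= c ->
  is_max_on (Icc a b) g M1 -> is_max_on (Icc b c) g M2 ->
  is_max_on (Icc a c) g (Rmax M1 M2).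
Proof.
  intros Hab Hbc [[s1 [I1 E1]] H1] [[s2 [I2 E2]] H2]. unfold Icc in *.
  split.
  - unfold Rmax; destruct (Rle_dec M1 M2).
    + exists s2; split; [lra | exact E2].
    + exists s1; split; [lra | exact E1].
  - intros s Hs. destruct (Rle_dec s b).
    + apply Rle_trans with M1; [apply H1; lra | apply Rmax_l].
    + apply Rle_trans with M2; [apply H2; lra | apply Rmax_r].
Qed.

Lemma finitely_many_bounded (b : nat -> R) (N : nat) :
  exists M, forall n, (n < N)%nat -> b n <= M.
Proof.
  induction N as [|N [M HM]].
  - exists 0. intros n Hn. lia.
  - exists (Rmax M (b N)). intros n Hn.
    destruct (Nat.eq_dec n N) as [->|Hne].
    + apply Rmax_r.
    + apply Rle_trans with M; [apply HM; lia | apply Rmax_l].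
Qed.

Lemma partition_le (T : R) (N : nat) (t : nat -> R) (n m : nat) :
  is_partition T N t -> (n <= m <= N)%nat -> t n <= t m.
Proof.
  intros [_ [_ [_ Hlt]]] [Hnm HmN]. induction Hnm as [|m Hnm IH].
  - lra.
  - apply Rle_trans with (t m); [apply IH; lia | left; apply Hlt; lia].
Qed.

Lemma partition_bounds (T : R) (N : nat) (t : nat -> R) (n : nat) :
  is_partition T N t -> (n <= N)%nat -> 0 <= t n <= T.
Proof.
  intros Ht Hn. pose proof Ht as [_ [H0 [HT _]]].
  split; [rewrite -H0 | rewrite -HT]; apply (partition_le T N); trivial; lia.
Qed.

Lemma partition_locate (T : R) (N : nat) (t : nat -> R) (s : R) :
  is_partition T N t -> 0 < s <= T ->
  exists n, (n < N)%nat /\ t n < s <= t (S n).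
Proof.
  intros [_ [H0 [HT _]]] [Hs0 HsT]. rewrite -HT in HsT.
  revert HsT. generalize N. clear HT N. intros N.
  induction N as [|N IH]; intros Hs.
  - lra.
  - destruct (Rle_dec s (t N)) as [Hle|Hgt].
    + destruct (IH Hle) as [n [Hn HI]]. exists n. split; [lia | exact HI].
    + exists N. split; [lia | lra].
Qed.

End RealIntervals.

(** * Difference quotients, and Riemann integrals under bounded linear maps *)

Section Calculus.

Context {H : CompleteNormedModule R_AbsRing}.

Lemma within_is_filter_lim (I : R -> Prop) (x : R) :
  is_filter_lim (within I (locally x)) x.
Proof. intros P HP. now apply filter_le_within. Qed.

Lemma is_derive_within_continuous_on (I : R -> Prop) (g : R -> H)
  (x : R) (l : H) :
  is_derive_within I g x l ->
  filterlim g (within I (locally x)) (locally (g x)).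
Proof.
  intros Hg.
  apply (filterdiff_continuous_aux (U := R_NormedModule) (V := H) g).
  - now exists (fun h : R => scal h l).
  - apply within_is_filter_lim.
Qed.

(** Dividing the remainder of the differential by [h] gives the limit. Both the generator of the
    semigroup and the left derivative of the error are handled as limits of such quotients. *)
Lemma is_derive_within_quotient (I : R -> Prop) (g : R -> H) (x : R) (l : H) :
  is_derive_within I g x l ->
  filterlim (fun h : R => scal (/ h) (minus (g (x + h)) (g x)))
    (within (fun h => h <> 0 /\ I (x + h)) (locally 0)) (locally l).
Proof.
  intros [_ Hg]. specialize (Hg x (within_is_filter_lim I x)).
  apply filterlim_locally. intros eps.
  (* Half of [eps], because the differential bounds the remainder non-strictly while the ball is
     open. *)
  destruct (Hg (pos_div_2 eps)) as [d Hd].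
  exists d. intros h Hh [Hh0 HI].
  apply (norm_compat1 (V := H)).
  assert (Hxh : ball x d (x + h)).
  { revert Hh. change (Rabs (h - 0) < d -> Rabs (x + h - x) < d).
    now replace (x + h - x) with (h - 0) by ring. }
  specialize (Hd (x + h) Hxh HI).
  assert (Hminus : forall a b : R, minus (a + b) a = b).
  { intros a b. change (a + b - a = b). ring. }
  rewrite Hminus in Hd.
  assert (Heq : minus (scal (/ h) (minus (g (x + h)) (g x))) l
    = scal (/ h) (minus (minus (g (x + h)) (g x)) (scal h l))).
  { rewrite [RHS]scal_minus_distr_l scal_assoc.
    change (mult (/ h) h) with (/ h * h). rewrite -> Rinv_l by exact Hh0.
    change 1 with (@one R_AbsRing). now rewrite scal_one. }
  rewrite Heq. apply Rle_lt_trans with (1 := norm_scal (V := H) _ _).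
  change (@abs R_AbsRing (/ h)) with (Rabs (/ h)).
  change (norm h) with (Rabs h) in Hd. simpl in Hd.
  apply Rle_lt_trans with (Rabs (/ h) * (eps / 2 * Rabs h)).
  - apply Rmult_le_compat_l; [apply Rabs_pos | exact Hd].
  - rewrite Rabs_inv. pose proof (Rabs_no_R0 h Hh0) as Hah.
    replace (/ Rabs h * (eps / 2 * Rabs h)) with (eps / 2) by (field; exact Hah).
    pose proof (cond_pos eps). lra.
Qed.

Lemma is_derive_quotient_right (g : R -> H) (x : R) (l : H) :
  is_derive g x l ->
  filterlim (fun h : R => scal (/ h) (minus (g (x + h)) (g x)))
    (at_right 0) (locally l).
Proof.
  intros [Hl Hg].
  assert (Hw : is_derive_within (fun _ => True) g x l).
  { split; [exact Hl|]. intros y Hy eps.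
    apply filter_le_within. apply Hg.
    intros P HP. generalize (Hy P HP). unfold within.
    apply filter_imp. now auto. }
  apply is_derive_within_quotient in Hw.
  intros P HP. specialize (Hw P HP). revert Hw.
  unfold filtermap, at_right, within.
  apply filter_imp. intros h Hh Hpos. apply Hh. split; [lra | trivial].
Qed.

Lemma is_derive_within_quotient_left (T : R) (g : R -> H) (x : R) (l : H) :
  0 < x <= T -> is_derive_within (Icc 0 T) g x l ->
  filterlim (fun h : R => scal (/ h) (minus (g (x + h)) (g x)))
    (at_left 0) (locally l).
Proof.
  intros [Hx HxT] Hg. apply is_derive_within_quotient in Hg.
  intros P HP. destruct (Hg P HP) as [d Hd].
  (* The radius [Rmin d x] keeps [x + h] positive, and [h < 0] keeps it below [T]. *)
  assert (Hm : 0 < Rmin d x) by (apply Rmin_glb_lt; [apply cond_pos | lra]).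
  exists (mkposreal _ Hm). intros h Hh Hneg.
  assert (Hh' : Rabs (h - 0) < Rmin d x) by exact Hh.
  pose proof (Rmin_l d x). pose proof (Rmin_r d x).
  apply Hd.
  - change (Rabs (h - 0) < d). lra.
  - rewrite -> Rminus_0_r, Rabs_left in Hh' by lra. unfold Icc. lra.
Qed.

Lemma is_linear_Riemann_sum (l : H -> H) (g : R -> H) (ptd : SF_seq) :
  is_linear l -> Riemann_sum (fun x => l (g x)) ptd = l (Riemann_sum g ptd).
Proof.
  intros Hl. induction ptd as [x0|h s IH] using SF_cons_ind.
  - symmetry. exact (linear_zero l Hl).
  - rewrite !Riemann_sum_cons IH (linear_plus _ Hl).
    now rewrite (linear_scal _ Hl).
Qed.

(** Riemann sums commute with [l] by linearity, and continuity of [l] carries this to the limit. *)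
Lemma is_RInt_linear (l : H -> H) (g : R -> H) (a b : R) (v : H) :
  is_linear l -> is_RInt g a b v -> is_RInt (fun x => l (g x)) a b (l v).
Proof.
  intros Hl Hg. unfold is_RInt.
  apply filterlim_ext
    with (fun ptd => l (scal (sign (b - a)) (Riemann_sum g ptd))).
  - intros ptd. rewrite (linear_scal _ Hl). now rewrite is_linear_Riemann_sum.
  - apply (filterlim_comp _ _ _ _ l _ (locally v)); [exact Hg|].
    apply (linear_cont l v Hl).
Qed.

End Calculus.

(** * Inner-product inequalities and coercivity *)

Section InnerProduct.

Context {H : CompleteNormedModule R_AbsRing} (ip : H -> H -> R)
  (hH : is_hilbert H ip).

Lemma ip_self (x : H) : ip x x = norm x ^ 2.
Proof.
  rewrite (ip_norm _ _ hH). simpl. rewrite Rmult_1_r.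
  symmetry. apply sqrt_sqrt, (ip_nonneg _ _ hH).
Qed.

Lemma ip_opp_l (x y : H) : ip (opp x) y = - ip x y.
Proof.
  rewrite -scal_opp_one (ip_scal_l _ _ hH).
  change (- 1 * ip x y = - ip x y). ring.
Qed.

Lemma ip_minus_l (x y z : H) : ip (minus x y) z = ip x z - ip y z.
Proof.
  unfold minus. rewrite (ip_plus_l _ _ hH) ip_opp_l. ring.
Qed.

(** With [a = |x|] and [b = |y|], expanding [|b x - a y|^2 >= 0] gives [2 a b (a b - (x, y)) >= 0].
    A nonzero [a b] can be divided out; otherwise one of the vectors is zero. *)
Lemma cauchy_schwarz (x y : H) : ip x y <= norm x * norm y.
Proof.
  set (a := norm x). set (b := norm y).
  pose proof (norm_ge_0 x : 0 <= a). pose proof (norm_ge_0 y : 0 <= b).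
  assert (Hpos : 0 <= 2 * (a * b) * (a * b - ip x y)).
  { pose proof (ip_nonneg _ _ hH (minus (scal b x) (scal a y))) as Hn.
    rewrite ip_minus_l (ip_sym _ _ hH _ (minus _ _)) !ip_minus_l in Hn.
    rewrite (ip_sym _ _ hH (scal a y) (minus _ _)) ip_minus_l in Hn.
    rewrite !(ip_scal_l _ _ hH) in Hn.
    rewrite !(ip_sym _ _ hH _ (scal _ _)) !(ip_scal_l _ _ hH) in Hn.
    rewrite !ip_self (ip_sym _ _ hH y x) in Hn. fold a b in Hn. nra. }
  destruct (Req_dec (a * b) 0) as [Hz|Hnz].
  - assert (Hcase : x = zero \/ y = zero).
    { destruct (Rmult_integral _ _ Hz); [left|right]; now apply (norm_eq_zero (V := H)). }
    rewrite Hz.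
    assert (Hip0 : forall z, ip zero z = 0).
    { intros z. rewrite -(scal_zero_l x) (ip_scal_l _ _ hH).
      apply Rmult_0_l. }
    destruct Hcase as [-> | ->]; [|rewrite (ip_sym _ _ hH)]; rewrite Hip0; lra.
  - assert (0 < a * b) by (pose proof (Rmult_le_pos a b); lra). nra.
Qed.

(** Provides the continuity that lets a limit of difference quotients be paired with a fixed
    vector. *)
Lemma is_linear_ip (y : H) :
  is_linear (V := R_NormedModule) (fun x : H => ip x y).
Proof.
  split.
  - intros; apply (ip_plus_l _ _ hH).
  - intros; apply (ip_scal_l _ _ hH).
  (* The [+ 1] makes the constant strictly positive even when [y] is zero. *)
  - exists (norm y + 1). pose proof (norm_ge_0 y). split; [lra|].
    intros x. change (Rabs (ip x y) <= (norm y + 1) * norm x).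
    pose proof (cauchy_schwarz x y). pose proof (norm_ge_0 x).
    pose proof (cauchy_schwarz (opp x) y) as Hc.
    rewrite ip_opp_l norm_opp in Hc.
    apply Rabs_le. nra.
Qed.

Lemma ip_left_derivative_nonneg (e : R -> H) (s : R) (d : H) :
  filterlim (fun h : R => scal (/ h) (minus (e (s + h)) (e s)))
    (at_left 0) (locally d) ->
  at_left 0 (fun h => norm (e (s + h)) <= norm (e s)) ->
  0 <= ip d (e s).
Proof.
  intros Hd Hmax.
  apply (filterlim_le (F := at_left 0) (fun _ => 0)
    (fun h => ip (scal (/ h) (minus (e (s + h)) (e s))) (e s))
    (Finite 0) (Finite (ip d (e s)))).
  - generalize Hmax. unfold at_left, within. apply filter_imp.
    intros h Hh Hneg. specialize (Hh Hneg).
    rewrite (ip_scal_l _ _ hH) ip_minus_l ip_self.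
    pose proof (cauchy_schwarz (e (s + h)) (e s)).
    pose proof (norm_ge_0 (e s)).
    pose proof (Rinv_lt_0_compat h Hneg).
    assert (ip (e (s + h)) (e s) <= norm (e s) ^ 2) by nra.
    (* Both factors, [/ h] and [(e (s + h), e s) - |e s|^2], are nonpositive. *)
    rewrite -Rmult_opp_opp. apply Rmult_le_pos; lra.
  - apply filterlim_const.
  - apply (filterlim_comp _ _ _ _ (fun x => ip x (e s)) _ (locally d) _ Hd).
    exact (linear_cont _ d (is_linear_ip (e s))).
Qed.

(** Pairing with [w] gives [lambda |w|^2 <= (a, w) <= (d + a, w) = - (r, w) <= |r| |w|], and a
    nonzero [|w|] cancels. *)
Lemma norm_le_of_coercive (lambda : R) (d a r w : H) :
  0 < lambda -> lambda * norm w ^ 2 <= ip a w -> 0 <= ip d w ->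
  plus d a = opp r -> lambda * norm w <= norm r.
Proof.
  intros Hl Hc Hd Heq.
  pose proof (ip_plus_l _ _ hH d a w) as Hp. rewrite Heq in Hp.
  pose proof (cauchy_schwarz (opp r) w) as Hcs. rewrite norm_opp in Hcs.
  pose proof (norm_ge_0 w). pose proof (norm_ge_0 r).
  destruct (Req_dec (norm w) 0) as [->|Hw]; [lra|].
  apply Rmult_le_reg_r with (norm w); [lra|]. nra.
Qed.

(** Since [B x] lies in [V], symmetry of [B] gives [(A x, x) = (B (B x), x) = |B x|^2], which the
    squared Poincare inequality bounds from below. *)
Lemma sqrt_op_coercive (D : H -> Prop) (A : H -> H) (V : H -> Prop)
  (B : H -> H) (lambda : R) (x : H) :
  is_sqrt_op ip D A V B -> 0 < lambda ->
  (forall v, V v -> norm v <= / sqrt lambda * norm (B v)) ->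
  D x -> lambda * norm x ^ 2 <= ip (A x) x.
Proof.
  intros [[_ [_ Hsa]] [_ [HD HA]]] Hl HP Hx.
  rewrite (HA x Hx). destruct (proj1 (HD x) Hx) as [Vx VBx].
  rewrite (proj1 (Hsa x (B x)) (conj Vx eq_refl) (B x) VBx) ip_self.
  specialize (HP x Vx). pose proof (sqrt_lt_R0 _ Hl) as Hs.
  assert (Hx' : sqrt lambda * norm x <= norm (B x)).
  { apply Rmult_le_reg_l with (/ sqrt lambda); [now apply Rinv_0_lt_compat|].
    rewrite <- Rmult_assoc, Rinv_l by lra. lra. }
  rewrite <- (sqrt_sqrt lambda) at 1 by lra.
  replace (sqrt lambda * sqrt lambda * norm x ^ 2)
    with ((sqrt lambda * norm x) ^ 2) by ring.
  apply pow_incr. split; [|exact Hx'].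
  apply Rmult_le_pos; [lra | apply norm_ge_0].
Qed.

End InnerProduct.

(** * Differences under a linear operator with domain *)

Section LinearOperator.

Context {H : CompleteNormedModule R_AbsRing} (D : H -> Prop) (A : H -> H)
  (hlin : is_linear_op D A).

Lemma dom_minus (x y : H) : D x -> D y -> D (minus x y).
Proof.
  intros Hx Hy. unfold minus. rewrite -scal_opp_one.
  apply (dom_plus _ _ hlin); [exact Hx | now apply (dom_scal _ _ hlin)].
Qed.

Lemma op_minus (x y : H) : D x -> D y -> A (minus x y) = minus (A x) (A y).
Proof.
  intros Hx Hy. unfold minus. rewrite -(scal_opp_one y) -(scal_opp_one (A y)).
  rewrite -(op_scal _ _ hlin) //.
  apply (op_plus _ _ hlin); [exact Hx | now apply (dom_scal _ _ hlin)].
Qed.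

End LinearOperator.

(** * The semigroup, its orbit integrals, and membership of the nodal values in the domain *)

Section Semigroup.

Context {H : CompleteNormedModule R_AbsRing} (D : H -> Prop) (A : H -> H)
  (E : R -> H -> H) (hE : is_semigroup_exp D A E).

(** [E t] commutes with [E h], so it maps the difference quotients at [x] to those at [E t x]. Being
    bounded, it preserves their limit, and existence of that limit is membership in [D]. *)
Lemma semigroup_dom (t : R) (x : H) : 0 <= t -> D x -> D (E t x).
Proof.
  intros Ht Hx. pose proof (exp_bounded _ _ _ hE t Ht) as Hlin.
  apply (exp_generator _ _ _ hE (E t x) (E t (opp (A x)))).
  apply filterlim_ext_loc
    with (fun h : R => E t (scal (/ h) (minus (E h x) x))).
  - apply filter_forall with (P := fun h => 0 < h -> _).
    intros h Hh. rewrite (linear_scal _ Hlin) (linear_minus _ _ _ Hlin).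
    rewrite <- !(Defs.exp_plus _ _ _ hE) by lra. now rewrite Rplus_comm.
  - apply (filterlim_comp _ _ _ _ (E t) _ (locally (opp (A x)))).
    + now apply (exp_generator _ _ _ hE).
    + apply (linear_cont _ _ Hlin).
Qed.

(* [E t] is unconstrained for [t < 0]: freezing it there at [E 0] gives an orbit
   that is continuous on the whole line. *)
Definition orbit (x : H) (t : R) : H := E (Rmax 0 t) x.

Lemma orbit_eq (x : H) (t : R) : 0 <= t -> orbit x t = E t x.
Proof. intros Ht. unfold orbit. now rewrite Rmax_right. Qed.

Lemma orbit_continuous (x : H) (t : R) : continuous (orbit x) t.
Proof.
  assert (Hin : forall s, 0 <= Rmax 0 s) by (intros; apply Rmax_l).
  apply (filterlim_comp _ _ _ (Rmax 0) (fun s => E s x) _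
           (within (fun s => 0 <= s) (locally (Rmax 0 t)))).
  - intros P [d Hd]. exists d. intros y Hy. apply Hd; [|apply Hin].
    revert Hy. change (Rabs (y - t) < d -> Rabs (Rmax 0 y - Rmax 0 t) < d).
    intros Hy. apply Rle_lt_trans with (2 := Hy). unfold Rmax.
    repeat destruct (Rle_dec _ _); unfold Rabs;
      repeat destruct (Rcase_abs _); lra.
  - apply (exp_continuous _ _ _ hE x). apply Hin.
Qed.

Lemma orbit_ex_RInt (x : H) (a b : R) : ex_RInt (orbit x) a b.
Proof. apply (ex_RInt_continuous (orbit x)). intros; apply orbit_continuous. Qed.

(** [E h] passes under the integral and shifts its variable, which leaves the integral from [h] to
    [k + h]. *)
Lemma semigroup_RInt_orbit (x : H) (k h : R) :
  0 <= k -> 0 <= h ->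
  E h (RInt (orbit x) 0 k) =
  minus (RInt (orbit x) 0 (k + h)) (RInt (orbit x) 0 h).
Proof.
  intros Hk Hh.
  pose proof (is_RInt_linear (E h) _ _ _ _ (exp_bounded _ _ _ hE h Hh)
    (RInt_correct _ _ _ (orbit_ex_RInt x 0 k))) as H1.
  rewrite <- (RInt_Chasles (orbit x) 0 h (k + h)) by apply orbit_ex_RInt.
  rewrite plus_comm. unfold minus. rewrite -plus_assoc plus_opp_r plus_zero_r.
  rewrite -(is_RInt_unique _ _ _ _ H1).
  apply is_RInt_unique.
  (* The factors [1] put the shift in the form of an affine substitution of slope one. *)
  apply is_RInt_ext with (fun y : R => scal 1 (orbit x (1 * y + h))).
  - rewrite -> Rmin_left, Rmax_right by lra. intros s Hs.
    change 1 with (@one R_AbsRing) at 1. rewrite scal_one Rmult_1_l.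
    rewrite -> !orbit_eq by lra. rewrite Rplus_comm. apply (Defs.exp_plus _ _ _ hE); lra.
  - apply (is_RInt_comp_lin (orbit x)).
    replace (1 * 0 + h) with h by ring. replace (1 * k + h) with (k + h) by ring.
    apply (RInt_correct (orbit x)), orbit_ex_RInt.
Qed.

(** Integration in time gains regularity for every vector [x]. By the shift identity, the semigroup
    quotient at the integral is the quotient at [0] of [h -> F (k + h) - F h], and [F] has
    derivative [orbit x]. *)
Lemma RInt_orbit_dom (x : H) (k : R) : 0 <= k -> D (RInt (orbit x) 0 k).
Proof.
  intros Hk.
  pose (F := fun r => RInt (orbit x) 0 r).
  assert (HF : forall r, is_derive F r (orbit x r)).
  { intros r. apply is_derive_RInt with 0; [|apply orbit_continuous].
    apply filter_forall. intros b.
    apply (RInt_correct (orbit x)), orbit_ex_RInt. }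
  assert (HG : is_derive (fun h => minus (F (k + h)) (F h)) 0
                 (minus (orbit x k) (orbit x 0))).
  { apply @is_derive_minus; [|apply HF].
    replace (orbit x k) with (scal 1 (orbit x (k + 0))).
    - apply (is_derive_comp F (fun h : R => k + h) 0 (orbit x (k + 0)) 1).
      + apply HF.
      + auto_derive; trivial.
    - rewrite Rplus_0_r. apply (scal_one (orbit x k)). }
  apply is_derive_quotient_right in HG.
  apply (exp_generator _ _ _ hE (RInt (orbit x) 0 k)
           (minus (orbit x k) (orbit x 0))).
  revert HG. apply filterlim_ext_loc.
  apply filter_forall with (P := fun h => 0 < h -> _).
  intros h Hh. apply f_equal.
  rewrite -> semigroup_RInt_orbit by lra. unfold F.
  rewrite Rplus_0_l Rplus_0_r. apply f_equal.
  (* The two quotients differ only by [F 0], an integral over a degenerate interval. *)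
  rewrite (RInt_point 0). apply (@minus_zero_r H).
Qed.

(** Substitution [r = (1 - tau) k]. Keeping the factor [k] on the left avoids dividing by it, so
    [k = 0] is covered. *)
Lemma scal_phi1 (k : R) (x : H) :
  0 <= k -> scal k (phi1 E k x) = RInt (orbit x) 0 k.
Proof.
  intros Hk. unfold phi1.
  rewrite (RInt_ext _ (fun y => orbit x (- k * y + k))).
  2:{ rewrite -> Rmin_left, Rmax_right by lra. intros s Hs.
      replace (- k * s + k) with ((1 - s) * k) by ring.
      rewrite orbit_eq; trivial. apply Rmult_le_pos; lra. }
  assert (Hex : ex_RInt (fun y => orbit x (- k * y + k)) 0 1).
  { apply (ex_RInt_continuous (fun y => orbit x (- k * y + k))). intros s _.
    apply (continuous_comp (fun y => - k * y + k) (orbit x)).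
    - apply @ex_derive_continuous. auto_derive. trivial.
    - apply orbit_continuous. }
  pose proof (RInt_comp_lin (orbit x) (- k) k 0 1 (orbit_ex_RInt x _ _)) as Hc.
  rewrite -> RInt_scal in Hc by exact Hex.
  replace (- k * 0 + k) with k in Hc by ring.
  replace (- k * 1 + k) with 0 in Hc by ring.
  (* The substitution is orientation-reversing: the integral runs from [k] to [0], and the resulting
     sign cancels that of the slope [- k]. *)
  rewrite <- (opp_RInt_swap (orbit x)) in Hc by apply orbit_ex_RInt.
  change (- k) with (opp k : R_AbsRing) in Hc at 1. rewrite scal_opp_l in Hc.
  apply (f_equal (@opp H)) in Hc. now rewrite !opp_opp in Hc.
Qed.

(** Both terms of the recursion stay in [D]: the semigroup preserves it, and the scaled [phi1] maps
    all of [H] into it. *)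
Lemma exp_midpoint_dom (hlin : is_linear_op D A) (f : R -> H) (T : R)
  (N : nat) (t : nat -> R) (u0 : H) (n : nat) :
  is_partition T N t -> D u0 -> (n <= N)%nat -> D (exp_midpoint E f t u0 n).
Proof.
  intros Ht Hu0 Hn. induction n as [|n IH]; [exact Hu0|].
  assert (Hstep : 0 <= step t n).
  { unfold step. destruct Ht as [_ [_ [_ Hlt]]]. specialize (Hlt n Hn). lra. }
  simpl. apply (dom_plus _ _ hlin).
  - apply semigroup_dom; [exact Hstep | apply IH; lia].
  - rewrite -> scal_phi1 by exact Hstep. now apply RInt_orbit_dom.
Qed.

End Semigroup.

(** * The interpolant, its error and its residual *)

Section Interpolant.

Context {H : CompleteNormedModule R_AbsRing}.

(** At the left node the formula comes from the value at [0] when [n] is zero, and otherwise from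
    the right end of the preceding subinterval. Closed subintervals are what the existence of a
    maximum requires. *)
Lemma interpolant_closed (T : R) (N : nat) (t : nat -> R) (Un : nat -> H)
  (U : R -> H) (n : nat) (s : R) :
  is_partition T N t -> is_pw_linear_interpolant N t Un U ->
  (n < N)%nat -> t n <= s <= t (S n) ->
  U s = plus (Un n) (scal (s - t n) (slope t Un n)).
Proof.
  intros [_ [H0 [_ Hlt]]] [HU0 HU] Hn [Hs1 Hs2].
  destruct (Req_dec s (t n)) as [->|Hne]; [|apply HU; [exact Hn | lra]].
  rewrite Rminus_diag. change 0 with (@zero R_AbsRing).
  rewrite scal_zero_l plus_zero_r.
  destruct n as [|m]; [now rewrite H0|].
  assert (Hm : t m < t (S m)) by (apply Hlt; lia).
  rewrite -> (HU m) by (lia || lra). unfold slope, step.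
  rewrite scal_assoc.
  change (mult (t (S m) - t m) (/ (t (S m) - t m)))
    with ((t (S m) - t m) * / (t (S m) - t m)).
  rewrite -> Rinv_r by lra. change 1 with (@one R_AbsRing). rewrite scal_one.
  unfold minus. rewrite plus_comm -plus_assoc plus_opp_l.
  apply plus_zero_r.
Qed.

Lemma affine_continuous (a b : H) (c x : R) :
  continuous (fun s : R => plus a (scal (s - c) b)) x.
Proof.
  apply (continuous_plus (V := H) (fun _ => a) (fun s => scal (s - c) b));
    [apply continuous_const|].
  apply (continuous_comp (fun s : R => s - c) (fun h : R => scal h b)).
  - apply @ex_derive_continuous. auto_derive. trivial.
  - exact (linear_cont _ _ (is_linear_scal_l b)).
Qed.

(** Induction over the nodes: each step adjoins one closed subinterval, on which [U] is affine and
    the error therefore continuous. *)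
Lemma error_max_exists (T : R) (N : nat) (t : nat -> R) (Un : nat -> H)
  (U u : R -> H) :
  is_partition T N t -> is_pw_linear_interpolant N t Un U ->
  continuous_on (Icc 0 T) u ->
  exists M, is_max_on (Icc 0 T) (fun s => norm (minus (u s) (U s)) ^ 2) M.
Proof.
  intros Ht HU Hu. pose proof Ht as [_ [H0 [HT Hlt]]].
  set (G := fun s => norm (minus (u s) (U s)) ^ 2).
  enough (Hm : forall m, (m <= N)%nat -> exists M, is_max_on (Icc 0 (t m)) G M).
  { rewrite -HT. now apply Hm. }
  intros m. induction m as [|m IH]; intros HmN.
  - exists (G 0). rewrite H0. split.
    + exists 0. split; [unfold Icc; lra | trivial].
    + intros s [Hs1 Hs2]. replace s with 0 by lra. lra.
  - destruct IH as [M1 HM1]; [lia|].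
    assert (Hbm : 0 <= t m) by (apply (partition_bounds T N t m Ht); lia).
    assert (HbS : t (S m) <= T)
      by (apply (partition_bounds T N t (S m) Ht); lia).
    assert (Hlt' : t m < t (S m)) by (apply Hlt; lia).
    destruct (continuous_max_on G (t m) (t (S m))) as [M2 HM2]; [lra| |].
    2:{ exists (Rmax M1 M2).
        apply is_max_on_concat with (t m); trivial; lra. }
    intros x Hx.
    (* [Q] is affine on the whole line and agrees with [U] on the closed subinterval, so it replaces
       [U] in the continuity argument. *)
    set (Q := fun s => plus (Un m) (scal (s - t m) (slope t Un m))).
    assert (HGQ : forall s, Icc (t m) (t (S m)) s ->
              norm (minus (u s) (Q s)) ^ 2 = G s).
    { intros s Hs. unfold G.
      now rewrite (interpolant_closed T N t Un U m s Ht HU HmN Hs). }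
    rewrite -(HGQ x Hx).
    apply filterlim_ext_loc with (fun s => norm (minus (u s) (Q s)) ^ 2).
    { apply filter_forall with (P := fun s => Icc (t m) (t (S m)) s -> _).
      exact HGQ. }
    apply (filterlim_comp _ _ _ (fun s => norm (minus (u s) (Q s)))
             (fun r => r ^ 2) _ (locally (norm (minus (u x) (Q x))))).
    2:{ apply (ex_derive_continuous (fun r : R => r ^ 2)).
        auto_derive. trivial. }
    apply (filterlim_comp _ _ _ (fun s => minus (u s) (Q s)) norm _
             (locally (minus (u x) (Q x)))); [|apply (filterlim_norm (V := H))].
    apply (filterlim_comp_2 (G := locally (u x)) (H := locally (opp (Q x)))
             u (fun s => opp (Q s)) plus).
    + intros P HP. assert (HxT : Icc 0 T x) by (unfold Icc in *; lra).
      generalize (Hu x HxT P HP). unfold filtermap, within. apply filter_imp.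
      intros s Hs HI. apply Hs. unfold Icc in *. lra.
    + apply (filterlim_comp _ _ _ Q opp _ (locally (Q x)));
        [|apply (filterlim_opp (V := H))].
      apply (filterlim_filter_le_1 (F := locally x) Q);
        [apply filter_le_within | apply affine_continuous].
    + apply (filterlim_plus (V := H)).
Qed.

Lemma interpolant_dom (D : H -> Prop) (A : H -> H) (T : R) (N : nat)
  (t : nat -> R) (Un : nat -> H) (U : R -> H) :
  is_linear_op D A -> is_partition T N t ->
  is_pw_linear_interpolant N t Un U ->
  (forall n, (n <= N)%nat -> D (Un n)) ->
  forall s, 0 <= s <= T -> D (U s).
Proof.
  intros hlin Ht [HU0 HU] HD s Hs.
  destruct (Req_dec s 0) as [->|Hne].
  - rewrite HU0. apply HD. lia.
  - destruct (partition_locate T N t s Ht) as [n [Hn HI]]; [lra|].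
    rewrite (HU n s Hn HI). apply (dom_plus _ _ hlin); [apply HD; lia|].
    apply (dom_scal _ _ hlin). unfold slope. apply (dom_scal _ _ hlin).
    apply (dom_minus D A hlin); apply HD; lia.
Qed.

(** The residual may jump at the nodes, so it is bounded on each of the finitely many pieces;
    compactness serves for [f]. The bound makes the supremum finite. *)
Lemma residual_bounded (D : H -> Prop) (A : H -> H) (f : R -> H) (T : R)
  (N : nat) (t : nat -> R) (Un : nat -> H) (U Res : R -> H) :
  is_linear_op D A -> is_partition T N t ->
  is_pw_linear_interpolant N t Un U ->
  (forall n, (n <= N)%nat -> D (Un n)) ->
  continuous_on (Icc 0 T) f -> is_residual A f N t Un U Res ->
  exists M, forall s, 0 < s <= T -> norm (Res s) <= M.
Proof.
  intros hlin Ht [HU0 HU] HD Hf HRes.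
  assert (HT : 0 <= T)
    by (pose proof (partition_bounds T N t N Ht (Nat.le_refl N)); lra).
  destruct (continuous_max_on (fun s => norm (f s)) 0 T HT) as [Mf [_ HMf]].
  { intros x Hx. apply (filterlim_comp _ _ _ f norm _ (locally (f x)));
      [now apply Hf | apply (filterlim_norm (V := H))]. }
  (* The factor [T] bounds [s - t n] in the affine expression of [A (U s)]. *)
  destruct (finitely_many_bounded (fun n => norm (slope t Un n)
    + (norm (A (Un n)) + T * norm (A (slope t Un n))) + Mf) N) as [M HM].
  exists M. intros s Hs.
  destruct (partition_locate T N t s Ht Hs) as [n [Hn HI]].
  apply Rle_trans with (2 := HM n Hn).
  assert (Hslope : D (slope t Un n)).
  { apply (dom_scal _ _ hlin), (dom_minus D A hlin); apply HD; lia. }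
  rewrite (HRes n s Hn HI) (HU n s Hn HI).
  rewrite (op_plus _ _ hlin _ _ (HD n (Nat.lt_le_incl _ _ Hn))
             (dom_scal _ _ hlin _ _ Hslope)) (op_scal _ _ hlin _ _ Hslope).
  unfold minus. apply Rle_trans with (1 := norm_triangle (V := H) _ _).
  apply Rplus_le_compat.
  2:{ rewrite norm_opp. apply HMf. unfold Icc; lra. }
  apply Rle_trans with (1 := norm_triangle (V := H) _ _).
  apply Rplus_le_compat_l.
  apply Rle_trans with (1 := norm_triangle (V := H) _ _).
  apply Rplus_le_compat_l.
  apply Rle_trans with (1 := norm_scal (V := H) _ _).
  apply Rmult_le_compat_r; [apply norm_ge_0|].
  change (Rabs (s - t n) <= T). rewrite -> Rabs_pos_eq by lra.
  assert (0 <= t n) by (apply (partition_bounds T N t n Ht); lia). lra.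
Qed.

(** Subintervals are closed on the right, so for small [h < 0] the point [s + h] stays in the
    subinterval of [s], even when [s] is a node. The left derivative of [U] is thus the very slope
    that enters [Res s]. *)
Lemma error_quotient_left (T : R) (N : nat) (t : nat -> R) (Un : nat -> H)
  (U u : R -> H) (n : nat) (s : R) (du : H) :
  is_partition T N t -> is_pw_linear_interpolant N t Un U ->
  (n < N)%nat -> t n < s <= t (S n) ->
  is_derive_within (Icc 0 T) u s du ->
  filterlim (fun h : R => scal (/ h)
      (minus (minus (u (s + h)) (U (s + h))) (minus (u s) (U s))))
    (at_left 0) (locally (minus du (slope t Un n))).
Proof.
  intros Ht HU Hn HI Hdu.
  assert (H0 : 0 <= t n) by (apply (partition_bounds T N t n Ht); lia).
  assert (HT : t (S n) <= T) by (apply (partition_bounds T N t (S n) Ht); lia).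
  apply is_derive_within_quotient_left in Hdu; [|lra].
  apply filterlim_ext_loc with (fun h : R =>
    plus (scal (/ h) (minus (u (s + h)) (u s))) (opp (slope t Un n))).
  - assert (Hd : 0 < s - t n) by lra.
    exists (mkposreal _ Hd). intros h Hh Hneg.
    assert (Hh' : Rabs (h - 0) < s - t n) by exact Hh.
    rewrite -> Rminus_0_r, Rabs_left in Hh' by exact Hneg.
    destruct HU as [_ HU].
    rewrite -> (HU n s Hn HI), (HU n (s + h) Hn) by lra.
    set (sl := slope t Un n).
    (* Splitting off [s - t n] exhibits [U s], then generalized to [q], in both errors, where it
       cancels. *)
    replace (s + h - t n) with (plus (s - t n) h : R)
      by (change (s - t n + h = s + h - t n :> R); ring).
    rewrite scal_distr_r plus_assoc.
    generalize (plus (Un n) (scal (s - t n) sl)). intros q.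
    replace (minus (minus (u (s + h)) (plus q (scal h sl))) (minus (u s) q))
      with (plus (minus (u (s + h)) (u s)) (opp (scal h sl))).
    + rewrite [RHS]scal_distr_l scal_opp_r scal_assoc.
      change (mult (/ h) h) with (/ h * h). rewrite -> Rinv_l by lra.
      change 1 with (@one R_AbsRing). now rewrite scal_one.
    + unfold minus. rewrite !opp_plus opp_opp plus_plus_swap.
      apply f_equal. rewrite (plus_comm (opp q)) -plus_assoc plus_opp_l.
      symmetry. apply plus_zero_r.
  - apply (filterlim_comp_2 (G := locally du)
             (H := locally (opp (slope t Un n)))
             _ (fun _ => opp (slope t Un n)) plus).
    + exact Hdu.
    + apply filterlim_const.
    + apply (filterlim_plus (V := H)).
Qed.

End Interpolant.

(** * The bound of the maximal error by the supremum of the residual *)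

Theorem mainTheorem5
  (H : CompleteNormedModule R_AbsRing) (ip : H -> H -> R)
  (hH : is_hilbert H ip)
  (D : H -> Prop) (A : H -> H)
  (hA : is_self_adjoint ip D A)
  (hApos : is_positive_definite ip D A)
  (lambda1 : R) (hlambda1 : 0 < lambda1)
  (hfirst : is_first_eigenvalue D A lambda1)
  (V : H -> Prop) (Ahalf : H -> H)
  (hsqrt : is_sqrt_op ip D A V Ahalf)
  (hPoincare : forall v : H, V v -> norm v <= / sqrt lambda1 * norm (Ahalf v))
  (E : R -> H -> H) (hE : is_semigroup_exp D A E)
  (T : R) (f : R -> H) (hf : is_C2_on (Icc 0 T) f)
  (u0 : H) (hu0 : D u0)
  (N : nat) (t : nat -> R) (ht : is_partition T N t)
  (u : R -> H) (hu : is_exact_solution D A T f u0 u)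
  (U : R -> H)
  (hU : is_pw_linear_interpolant N t (exp_midpoint E f t u0) U)
  (Res : R -> H)
  (hRes : is_residual A f N t (exp_midpoint E f t u0) U Res) :
  (forall s : R, 0 <= s <= T -> D (U s)) /\
  exists maxe supR : R,
    is_max_on (Icc 0 T) (fun s : R => norm (minus (u s) (U s)) ^ 2) maxe /\
    is_sup_on (fun s : R => 0 < s <= T) (fun s : R => norm (Res s) ^ 2) supR /\
    maxe <= 1 / lambda1 ^ 2 * supR.
Proof.
  pose proof (proj1 hA) as hlin.
  set (Un := exp_midpoint E f t u0) in *.
  assert (HDn : forall n, (n <= N)%nat -> D (Un n)).
  { intros n Hn. now apply (exp_midpoint_dom D A E hE hlin f T N). }
  assert (HDU := interpolant_dom D A T N t Un U hlin ht hU HDn).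
  split; [exact HDU|].
  destruct hu as [Hu0 Hu].
  assert (Huc : continuous_on (Icc 0 T) u).
  { intros x Hx. destruct (Hu x Hx) as [_ [du [Hdu _]]].
    now apply is_derive_within_continuous_on with du. }
  assert (Hfc : continuous_on (Icc 0 T) f).
  { destruct hf as [f1 [_ [Hf1 _]]]. intros x Hx.
    apply is_derive_within_continuous_on with (f1 x). now apply Hf1. }
  destruct (error_max_exists T N t Un U u ht hU Huc) as [maxe Hmax].
  destruct (residual_bounded D A f T N t Un U Res hlin ht hU HDn Hfc hRes)
    as [M HM].
  assert (HT : 0 < T).
  { pose proof ht as [HN [H0 [_ Hlt]]].
    apply Rlt_le_trans with (t 1%nat).
    - rewrite -H0. apply Hlt. lia.
    - apply (partition_bounds T N t 1%nat ht). lia. }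
  destruct (completeness
    (fun y => exists s, 0 < s <= T /\ y = norm (Res s) ^ 2)) as [supR Hsup].
  { exists (M ^ 2). intros y [s [Hs ->]]. apply pow_incr.
    split; [apply norm_ge_0 | now apply HM]. }
  { exists (norm (Res T) ^ 2), T. split; [lra | trivial]. }
  exists maxe, supR. split; [exact Hmax|]. split; [exact Hsup|].
  assert (HR : forall s, 0 < s <= T -> norm (Res s) ^ 2 <= supR).
  { intros s Hs. apply (proj1 Hsup). now exists s. }
  destruct Hmax as [[s [Hs <-]] Hmax].
  apply Rmult_le_reg_l with (lambda1 ^ 2); [now apply pow_lt|].
  replace (lambda1 ^ 2 * (1 / lambda1 ^ 2 * supR)) with supR by (field; lra).
  rewrite -Rpow_mult_distr.
  (* At [s = 0] there is no left derivative within the interval; there the error vanishes and the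
     supremum is nonnegative. *)
  destruct (Req_dec s 0) as [->|Hs0].
  { rewrite (proj1 hU) Hu0. unfold Un; simpl exp_midpoint.
    unfold minus. rewrite plus_opp_r norm_zero.
    apply Rle_trans with (norm (Res T) ^ 2); [|apply HR; lra].
    rewrite -> Rmult_0_r, pow_i by lia. apply pow2_ge_0. }
  assert (HsT : 0 < s <= T) by (unfold Icc in Hs; lra).
  (* It remains to prove the unsquared pointwise bound [lambda1 |e s| <= |Res s|] at the
     maximizer. *)
  apply Rle_trans with (2 := HR s HsT). apply pow_incr. split.
  { apply Rmult_le_pos; [lra | apply norm_ge_0]. }
  destruct (partition_locate T N t s ht HsT) as [n [Hn HI]].
  destruct (Hu s Hs) as [HDu [du [Hdu Heq]]].
  assert (HDe : D (minus (u s) (U s)))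
    by (apply (dom_minus D A hlin); [exact HDu | now apply HDU]).
  apply (norm_le_of_coercive ip hH lambda1 (minus du (slope t Un n))
           (A (minus (u s) (U s))) (Res s)).
  - exact hlambda1.
  - now apply (sqrt_op_coercive ip hH D A V Ahalf).
  - apply (ip_left_derivative_nonneg ip hH (fun r => minus (u r) (U r)) s).
    + now apply (error_quotient_left T N t Un U u n s du).
    + exists (mkposreal s (proj1 HsT)). intros h Hh Hneg.
      assert (Hh' : Rabs (h - 0) < s) by exact Hh.
      rewrite -> Rminus_0_r, Rabs_left in Hh' by exact Hneg.
      (* Maximality was stated for squared norms; nonnegativity transfers it to the norms. *)
      apply Rsqr_incr_0; try apply norm_ge_0. rewrite !Rsqr_pow2.
      apply (Hmax (s + h)). unfold Icc. lra.
  (* Substituting [du + A u] for [f] in the residual turns [du - U' + A (u - U)] into [- Res s]. *)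
  - rewrite -> (op_minus D A hlin) by (trivial; now apply HDU).
    rewrite (hRes n s Hn HI) -Heq. unfold minus.
    rewrite [RHS]opp_plus opp_opp [LHS]plus_plus_swap plus_comm.
    now rewrite [in RHS]opp_plus.
Qed.
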